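(* There does not exist an integer $k$ such that $f_4(n+k)=b_4(n)$ for all integers $n\ge -k$.
   Context: For an integer $n$, a hyperquaternary representation of $n$ is an expression $n=\sum_{i\ge 0}\epsilon_i 4^i$ with finitely many nonzero $\epsilon_i$ and all $\epsilon_i\in\{0,1,2,3,4\}$; $f_4(n)$ denotes the number of such representations (so $f_4(n)=0$ for $n<0$). A balanced quaternary representation of $n$ is an expression $n=\sum_{i\ge 0}\epsilon_i 4^i$ with finitely many nonzero $\epsilon_i$ and all $\epsilon_i\in\{-2,-1,0,1,2\}$; $b_4(n)$ denotes the number of such representations. Representations differing only by leading zero digits are identified. *)

(* Defs.v *)
From mathcomp Require Import all_boot all_order all_algebra.
From mathcomp Require Import zify.
From mathcomp Require Import finmap.
From mathcomp Require Import boolp classical_sets functions cardinality.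

Set Implicit Arguments.
Unset Strict Implicit.
Unset Printing Implicit Defensive.
Import Order.TTheory GRing.Theory Num.Theory.
Local Open Scope fset_scope.
Local Open Scope classical_set_scope.
Local Open Scope ring_scope.

(* An expression n = \sum_i e_i 4^i with finitely many nonzero e_i is encoded
   by the polynomial p with coefficients p`_i = e_i, so that p.[4] = n;
   expressions differing only by leading zero digits are the same polynomial. *)
Definition representations (D : seq int) (n : int) : set {poly int} :=
  [set p : {poly int} | (forall i : nat, p`_i \in D) /\ p.[4] = n].

Definition hyperquaternary : int -> set {poly int} :=
  representations [:: 0; 1; 2; 3; 4].

Definition balanced_quaternary : int -> set {poly int} :=
  representations [:: -2; -1; 0; 1; 2].

(* fset_set sends infinite sets to the empty set; hyperquaternary_finite and
   balanced_quaternary_finite below show that this case does not occur. *)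
Definition f4 (n : int) : nat := #|` fset_set (hyperquaternary n) |.

Definition b4 (n : int) : nat := #|` fset_set (balanced_quaternary n) |.

Lemma representations_shift (D : seq int) (q : {poly int}) (d n : int) :
  representations D n (q * 'X + d%:P) ->
  [/\ d \in D, representations D q.[4] q & q.[4] * 4 + d = n].
Proof.
move=> [Hc Hn]; split.
- by have := Hc 0%N; rewrite coefD coefMX coefC /= add0r.
- split=> // i; have := Hc i.+1.
  by rewrite coefD coefMX coefC /= addr0.
- by rewrite -Hn !hornerE.
Qed.

Lemma representations_finite (D : seq int) (n : int) :
  (forall d m, d \in D -> m * 4 + d = n ->
     finite_set (representations D m)) ->
  finite_set (representations D n).
Proof.
move=> H.
pose A d : set {poly int} :=
  [set p | exists2 m, d \in D /\ m * 4 + d = n &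
    ((fun q => q * 'X + d%:P) @` representations D m) p].
apply: (@sub_finite_set _ _ (\bigcup_(d in [set` D]) A d)).
  move=> p Hp; have [q [d ep]] : exists q d, p = q * 'X + d%:P.
    elim/poly_ind: p {Hp} => [|q d _]; last by exists q, d.
    by exists 0, 0; rewrite mul0r add0r.
  rewrite {}ep in Hp *.
  have [hd hq hn] := representations_shift Hp.
  by exists d => //; exists q.[4] => //; exists q.
apply: bigcup_finite; first exact: finite_seq.
move=> d /= hd.
have [[m hm]|no] := pselect (exists m, m * 4 + d = n); last first.
  by apply: (@sub_finite_set _ _ set0) => // p [m [_ hm]]; case: no; exists m.
apply: (@sub_finite_set _ _ ((fun q => q * 'X + d%:P) @` representations D m)).
  move=> p [m' [_ hm'] h].
  suff -> : m = m' by [].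
  by lia.
exact: finite_image (H d m hd hm).
Qed.

Lemma hyperquaternary_ge0 (n : int) (p : {poly int}) :
  hyperquaternary n p -> 0 <= n.
Proof.
move=> [hc <-]; rewrite horner_coef sumr_ge0 // => i _.
rewrite mulr_ge0 ?exprn_ge0 //.
by have := hc i; rewrite !inE => /or4P[||| /orP[]] /eqP->.
Qed.

Lemma hyperquaternary_finite (n : int) : finite_set (hyperquaternary n).
Proof.
have neg m : m < 0 -> finite_set (hyperquaternary m).
  move=> m0; apply: (@sub_finite_set _ _ set0) => // p /hyperquaternary_ge0.
  by rewrite leNgt m0.
have zero : finite_set (hyperquaternary 0).
  apply: (@sub_finite_set _ _ [set 0]); last exact: finite_set1.
  move=> p; elim/poly_ind: p => [|q d IH] // /representations_shift [hd hq e].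
  have q0 := hyperquaternary_ge0 hq.
  move: hd; rewrite !inE => hd.
  have [e1 e2] : q.[4] = 0 /\ d = 0 by lia.
  by move: hq; rewrite e1 e2 => /IH /= ->; rewrite mul0r add0r.
have [N] := ubnP `|n|%N; elim: N n => // N IH n hn.
have [/neg//|n0] := ltP n 0.
have [->//|nn0] := eqVneq n 0.
apply: representations_finite => d m; rewrite !inE => hd e.
by apply: IH; lia.
Qed.

Lemma balanced_quaternary_finite (n : int) :
  finite_set (balanced_quaternary n).
Proof.
have zero : finite_set (balanced_quaternary 0).
  apply: (@sub_finite_set _ _ [set 0]); last exact: finite_set1.
  move=> p; elim/poly_ind: p => [|q d IH] // /representations_shift [hd hq e].
  move: hd; rewrite !inE => hd.
  have [e1 e2] : q.[4] = 0 /\ d = 0 by lia.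
  by move: hq; rewrite e1 e2 => /IH /= ->; rewrite mul0r add0r.
have [N] := ubnP `|n|%N; elim: N n => // N IH n hn.
have [->//|nn0] := eqVneq n 0.
apply: representations_finite => d m; rewrite !inE => hd e.
by apply: IH; lia.
Qed.

(* Main.v *)
(** Suppose f4 m = b4 (m - k) for all m >= 0.  Since b4 is constant on
    {4q - 1, 4q, 4q + 1} and b4 (4q + 2) = b4 q + b4 (q + 1) >= b4 (4q + 1),
    the function b4 can only decrease from n to n + 1 if n = 2 mod 4; as
    f4 4 > f4 5, this gives k = 4j + 2.  Then j works as well, because
    f4 p = f4 (4p + 1) = b4 (4 (p - j) - 1) = b4 (p - j).  As |j| < |k|, this
    descent cannot continue forever. *)
Require Import Defs.
From mathcomp Require Import all_boot all_order all_algebra.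
From mathcomp Require Import zify finmap classical_sets cardinality.
Set Implicit Arguments.
Unset Strict Implicit.
Unset Printing Implicit Defensive.
Import Order.TTheory GRing.Theory Num.Theory.
Local Open Scope classical_set_scope.
Local Open Scope ring_scope.

(** Multiplication by ['X] moves every digit up one place, so [d] becomes the lowest digit and the
    value [m] at 4 becomes [m * 4 + d]. *)
Definition append_digit (d : int) (q : {poly int}) : {poly int} :=
  q * 'X + d%:P.

Lemma append_digit_coef0 d q : (append_digit d q)`_0 = d.
Proof. by rewrite coefD coefMX coefC /= add0r. Qed.

Lemma append_digit_inj d : injective (append_digit d).
Proof.
move=> p q /polyP e; apply/polyP => i.
by have := e i.+1; rewrite !coefD !coefMX !coefC /= !addr0.
Qed.

Lemma representations_append (D : seq int) (n m d : int) (q : {poly int}) :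
  d \in D -> m * 4 + d = n -> representations D m q ->
  representations D n (append_digit d q).
Proof.
move=> hd e [hc hm]; split; last by rewrite !hornerE hm.
by case=> [|i]; rewrite coefD coefMX coefC /= ?add0r ?addr0.
Qed.

Lemma representations_split (D : seq int) (n : int) (p : {poly int}) :
  representations D n p ->
  exists d m q, [/\ d \in D, m * 4 + d = n, representations D m q
                  & p = append_digit d q].
Proof.
elim/poly_ind: p => [|q d _] h; last first.
  by have [hd hq e] := representations_shift h; exists d, q.[4], q.
(* The zero polynomial also has a lowest digit: it is 0 appended to itself. *)
have e : 0 = 0 * 'X + 0%:P :> {poly int} by rewrite mul0r add0r.
rewrite e in h; have [hd hq en] := representations_shift h.
by exists 0, 0.[4], 0.
Qed.

Lemma card_append_digit (A : set {poly int}) d : finite_set A ->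
  #|` fset_set (append_digit d @` A)| = #|` fset_set A|.
Proof.
move=> fA; rewrite fset_set_image // card_imfset //=.
exact: append_digit_inj.
Qed.

(** When the lowest digit is forced, deleting it is a bijection onto the representations of [m]. *)
Lemma card_representations1 (D : seq int) (n m d : int) :
  finite_set (representations D m) ->
  d \in D -> m * 4 + d = n ->
  (forall d' m', d' \in D -> m' * 4 + d' = n -> d' = d) ->
  #|` fset_set (representations D n)| = #|` fset_set (representations D m)|.
Proof.
move=> fm hd e uniq_d; rewrite -(card_append_digit d fm).
congr (#|` fset_set _|); apply/seteqP; split => [p | _ [q hq <-]].
  move=> /representations_split [d' [m' [q [hd' e' hq ->]]]].
  have ed := uniq_d _ _ hd' e'; rewrite ed in e' *.
  by exists q => //; have -> : m = m' by lia.
exact: representations_append hq.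
Qed.

(** The representations are sorted by their lowest digit, [d1] or [d2]; each class is counted by
    deleting that digit. *)
Lemma card_representations2 (D : seq int) (n m1 d1 m2 d2 : int) :
  finite_set (representations D m1) -> finite_set (representations D m2) ->
  d1 \in D -> m1 * 4 + d1 = n -> d2 \in D -> m2 * 4 + d2 = n -> d1 != d2 ->
  (forall d' m', d' \in D -> m' * 4 + d' = n -> d' = d1 \/ d' = d2) ->
  #|` fset_set (representations D n)| =
  (#|` fset_set (representations D m1)| + #|` fset_set (representations D m2)|)%N.
Proof.
move=> f1 f2 hd1 e1 hd2 e2 d12 only12.
rewrite -(card_append_digit d1 f1) -(card_append_digit d2 f2).
have -> : representations D n = append_digit d1 @` representations D m1
                            `|` append_digit d2 @` representations D m2.
  apply/seteqP; split => [p | _ [] [q hq <-]].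
  - move=> /representations_split [d' [m' [q [hd' e' hq ->]]]].
    have [ed|ed] := only12 _ _ hd' e'; rewrite ed in e' *; [left|right];
      exists q => //.
      by have -> : m1 = m' by lia.
    by have -> : m2 = m' by lia.
  - exact: representations_append hq.
  - exact: representations_append hq.
have g1 := finite_image (append_digit d1) f1.
have g2 := finite_image (append_digit d2) f2.
rewrite fset_setU // cardfsU -fset_setI //.
(* By inclusion-exclusion only disjointness remains; it holds because the constant coefficients [d1]
   and [d2] differ. *)
suff -> : append_digit d1 @` representations D m1
          `&` append_digit d2 @` representations D m2 = set0.
  by rewrite fset_set0 cardfs0 subn0.
apply/seteqP; split => // _ [[q1 _ <-] [q2 _ e]].
have := congr1 (fun p : {poly int} => p`_0) e.
by rewrite !append_digit_coef0 => ed; rewrite ed eqxx in d12.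
Qed.

Lemma f4_nonmul4 (m r : int) : 1 <= r <= 3 -> f4 (m * 4 + r) = f4 m.
Proof.
move=> hr; apply: (@card_representations1 _ _ m r) => //.
- exact: hyperquaternary_finite.
- by rewrite !inE; lia.
- by move=> d' m'; rewrite !inE; lia.
Qed.

(** The digits 0 and 4 are the only two of 0, ..., 4 that agree modulo 4. *)
Lemma f4_mul4 (m : int) : f4 (m * 4) = (f4 m + f4 (m - 1))%N.
Proof.
apply: (@card_representations2 _ _ m 0 (m - 1) 4) => //;
  try exact: hyperquaternary_finite; try lia.
by move=> d' m'; rewrite !inE; lia.
Qed.

Lemma b4_near_mul4 (m r : int) : -1 <= r <= 1 -> b4 (m * 4 + r) = b4 m.
Proof.
move=> hr; apply: (@card_representations1 _ _ m r) => //.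
- exact: balanced_quaternary_finite.
- by rewrite !inE; lia.
- by move=> d' m'; rewrite !inE; lia.
Qed.

(** Among the balanced digits only 2 and -2 agree modulo 4. *)
Lemma b4_mid (m : int) : b4 (m * 4 + 2) = (b4 m + b4 (m + 1))%N.
Proof.
apply: (@card_representations2 _ _ m 2 (m + 1) (-2)) => //;
  try exact: balanced_quaternary_finite; try lia.
by move=> d' m'; rewrite !inE; lia.
Qed.

Lemma f4_0_gt0 : (0 < f4 0)%N.
Proof.
rewrite cardfs_gt0; apply/fset0Pn; exists 0.
rewrite in_fset_set; last exact: hyperquaternary_finite.
by rewrite inE; split => [i|]; rewrite ?coef0 ?horner0.
Qed.

(** Both values contain [f4 1], but [f4 4] has the extra summand [f4 0], which is positive. *)
Lemma f4_5_lt_f4_4 : (f4 5 < f4 4)%N.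
Proof.
have := f4_mul4 1; have := @f4_nonmul4 1 1 isT; have := f4_0_gt0.
by rewrite mul1r subrr => h -> ->; rewrite -[X in (X < _)%N]addn0 ltn_add2l.
Qed.

Lemma b4_decrease (n : int) :
  (b4 (n + 1) < b4 n)%N -> exists q, n = q * 4 + 2.
Proof.
move=> h; have [q [r [hr en]]] : exists q r, -1 <= r <= 2 /\ n = q * 4 + r.
  (* Dividing [n + 1] instead of [n] moves the remainders from 0, ..., 3 to -1, ..., 2. *)
  by exists ((n + 1) %/ 4)%Z, (((n + 1) %% 4)%Z - 1); lia.
have [r2|r2] : r = 2 \/ r <= 1 by lia.
  by exists q; rewrite en r2.
exfalso; move: h; rewrite en b4_near_mul4; last by lia.
(* If [r = 1], then [n + 1 = q * 4 + 2] and [b4 q] is one of the two summands of [b4 (n + 1)]; if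
   [r <= 0], both values equal [b4 q]. *)
have [->|r1] : r = 1 \/ r <= 0 by lia.
  by rewrite -addrA b4_mid ltnNge leq_addr.
by rewrite -addrA b4_near_mul4 ?ltnn //; lia.
Qed.

Lemma shift_descent (k : int) :
  (forall m : int, 0 <= m -> f4 m = b4 (m - k)) ->
  exists2 j, k = j * 4 + 2 & forall m : int, 0 <= m -> f4 m = b4 (m - j).
Proof.
move=> fb; have [q ek] : exists q, 4 - k = q * 4 + 2.
  apply: b4_decrease; rewrite -(fb 4) //.
  have -> : 4 - k + 1 = 5 - k by lia.
  by rewrite -(fb 5) //; exact: f4_5_lt_f4_4.
(* From [4 - k = q * 4 + 2] follows [k = (- q) * 4 + 2]. *)
exists (- q) => [|m m0]; first by lia.
rewrite -(@f4_nonmul4 m 1) // fb; last by lia.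
have -> : m * 4 + 1 - k = (m - - q) * 4 + -1 by lia.
exact: b4_near_mul4.
Qed.

Lemma no_shift (k : int) : ~ (forall m : int, 0 <= m -> f4 m = b4 (m - k)).
Proof.
have [N] := ubnP `|k|%N; elim: N k => // N IH k hk /shift_descent [j ek].
(* Here [k = j * 4 + 2] gives [|j| < |k|], also for [j = 0] and [j = -1], where [k] is 2 and -2. *)
by apply: IH; lia.
Qed.

Theorem theorem1p1 :
  ~ (exists k : int, forall n : int, - k <= n -> f4 (n + k) = b4 n).
Proof.
move=> [k fb]; apply: (@no_shift k) => m m0.
by rewrite -fb ?subrK //; lia.
Qed.
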